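(* Let $\beta\in\mathbb{N}=\{0,1,2,\dots\}$, let $\alpha,\lambda\in\mathbb{D}\setminus\{0\}$, let $\phi_\alpha(z)=\dfrac{\alpha-z}{1-\overline{\alpha}z}$, and let $\phi=\phi_\alpha\circ(\lambda\phi_\alpha)$, i.e. $\phi(z)=\phi_\alpha(\lambda\phi_\alpha(z))$. Then the composition operator $C_\phi f=f\circ\phi$ is not complex symmetric on $A^2_\beta$.
   Context: $\mathbb{D}$ is the open unit disc. For $\beta>-1$, $A^2_\beta$ is the Hilbert space of analytic functions $f(z)=\sum_{n\ge0}\widehat f(n)z^n$ on $\mathbb{D}$ with inner product $\langle f,g\rangle=\sum_{n\ge0}\frac{n!\,\Gamma(2+\beta)}{\Gamma(n+2+\beta)}\widehat f(n)\overline{\widehat g(n)}$ (equivalently the $L^2$ inner product with respect to $(\beta+1)(1-|z|^2)^\beta dA(z)$). A conjugation is a conjugate-linear map $C$ with $C^2=I$ and $\langle Cf,Cg\rangle=\langle g,f\rangle$; a bounded operator $T$ is complex symmetric if $CT=T^*C$ for some conjugation $C$. *)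

(* Defs.v *)
From Stdlib Require Import Reals Factorial.
From Coquelicot Require Import Coquelicot.
Open Scope R_scope.

Fixpoint cpow (z : C) (n : nat) : C :=
  match n with O => RtoC 1 | S m => Cmult z (cpow z m) end.

(* An element f(z) = sum_n fhat(n) z^n of A^2_beta is represented by its
   Taylor coefficient sequence fhat : nat -> C. *)

(* weight n!Gamma(2+beta)/Gamma(n+2+beta) for beta a natural number *)
Definition wgt (beta n : nat) : R :=
  INR (fact n) * INR (fact (beta + 1)) / INR (fact (n + beta + 1)).

Definition inA2 (beta : nat) (f : nat -> C) : Prop :=
  ex_series (fun n => wgt beta n * (Cmod (f n)) ^ 2).

Definition ipA2 (beta : nat) (f g : nat -> C) : C :=
  (Series (fun n => wgt beta n * Re (Cmult (f n) (Cconj (g n)))),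
   Series (fun n => wgt beta n * Im (Cmult (f n) (Cconj (g n))))).

Definition psum_to (f : nat -> C) (z l : C) : Prop :=
  is_series (fun n => Cmult (f n) (cpow z n)) l.

Definition phi_a (a z : C) : C :=
  Cdiv (Cminus a z) (Cminus (RtoC 1) (Cmult (Cconj a) z)).

Definition is_comp_op (beta : nat) (phi : C -> C)
    (T : (nat -> C) -> (nat -> C)) : Prop :=
  forall f, inA2 beta f ->
    inA2 beta (T f) /\
    forall z, Cmod z < 1 -> forall l, psum_to f (phi z) l -> psum_to (T f) z l.

Definition is_conjugation (beta : nat) (Cj : (nat -> C) -> (nat -> C)) : Prop :=
  (forall f, inA2 beta f -> inA2 beta (Cj f)) /\
  (forall f g, inA2 beta f -> inA2 beta g ->
     forall n, Cj (fun k => Cplus (f k) (g k)) n = Cplus (Cj f n) (Cj g n)) /\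
  (forall (c : C) f, inA2 beta f ->
     forall n, Cj (fun k => Cmult c (f k)) n = Cmult (Cconj c) (Cj f n)) /\
  (forall f, inA2 beta f -> forall n, Cj (Cj f) n = f n) /\
  (forall f g, inA2 beta f -> inA2 beta g ->
     ipA2 beta (Cj f) (Cj g) = ipA2 beta g f).

Definition is_adjoint (beta : nat) (T S : (nat -> C) -> (nat -> C)) : Prop :=
  (forall f, inA2 beta f -> inA2 beta (S f)) /\
  forall f g, inA2 beta f -> inA2 beta g ->
    ipA2 beta (T f) g = ipA2 beta f (S g).

Definition complex_symmetric (beta : nat) (T : (nat -> C) -> (nat -> C)) : Prop :=
  exists Cj S, is_conjugation beta Cj /\ is_adjoint beta T S /\
    forall f, inA2 beta f -> forall n, Cj (T f) n = S (Cj f) n.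

(* Main.v *)
Require Import Defs.
From Stdlib Require Import Reals Factorial Lra Lia FunctionalExtensionality.
From Coquelicot Require Import Coquelicot.
Open Scope R_scope.

(* Let C be a conjugation with C T = T^* C. Then C maps the eigenvectors of T^* for 1 and for the
   conjugate of lambda to eigenvectors of T for 1 and lambda. The former are the kernels K and V
   representing f |-> f(alpha) and f |-> f'(alpha), since phi fixes alpha with derivative lambda.
   The latter are unique up to scalars: a solution of g o phi = mu g is determined by letting the
   iterates phi^k(z) tend to alpha and using a first order expansion of g at alpha, which gives
   constants for mu = 1 and multiples of phi_a alpha for mu = lambda. So C preserves, up to
   conjugation, the Gram matrix of an explicit pair: the cosine of the angle between K and V must
   be that of the angle between 1 and phi_a alpha. With r = |alpha|^2 and s = beta + 2 this reads
   s r / (1 + s r) = r / |phi_a alpha|^2, that is |phi_a alpha|^2 = r + 1/s. But the weights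
   decrease, so |phi_a alpha|^2 <= r + (1 - r)/s. *)

(** * Complex series *)

(** Convergence is split into components because [ipA2] is a pair of real series; [is_series_csum]
    links it to the convergence in [C] that [psum_to] speaks of. *)
Definition csum (a : nat -> C) (l : C) : Prop :=
  is_series (fun n => Re (a n)) (Re l) /\ is_series (fun n => Im (a n)) (Im l).

Definition CSeries (a : nat -> C) : C :=
  (Series (fun n => Re (a n)), Series (fun n => Im (a n))).

Lemma sum_n_C (a : nat -> C) (n : nat) :
  sum_n (G := C_NormedModule) a n = (sum_n (fun k => Re (a k)) n, sum_n (fun k => Im (a k)) n).
Proof.
  induction n as [|n IH].
  - rewrite !sum_O. now destruct (a 0%nat).
  - rewrite !sum_Sn, IH. now destruct (a (S n)).
Qed.

Lemma is_series_csum (a : nat -> C) (l : C) :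
  is_series (V := C_NormedModule) a l <-> csum a l.
Proof.
  unfold csum, is_series. split.
  - intros H. pose proof (proj1 (filterlim_locally _ _) H) as H'.
    split; apply filterlim_locally; intros eps;
      generalize (H' eps); apply filter_imp; intros n Hn;
      rewrite sum_n_C in Hn; apply Hn.
  - intros [H1 H2]. apply filterlim_locally. intros eps.
    pose proof (proj1 (filterlim_locally _ _) H1 eps) as H1'.
    pose proof (proj1 (filterlim_locally _ _) H2 eps) as H2'.
    generalize (filter_and _ _ H1' H2'). apply filter_imp. intros n [Hn1 Hn2].
    rewrite sum_n_C. split; assumption.
Qed.

Lemma csum_CSeries (a : nat -> C) (l : C) : csum a l -> CSeries a = l.
Proof.
  intros [H1 H2]. unfold CSeries.
  rewrite (is_series_unique _ _ H1), (is_series_unique _ _ H2). now destruct l.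
Qed.

Lemma csum_unique (a : nat -> C) (l m : C) : csum a l -> csum a m -> l = m.
Proof. intros H1 H2. rewrite <- (csum_CSeries _ _ H1). exact (csum_CSeries _ _ H2). Qed.

Lemma csum_plus (a b : nat -> C) (l m : C) :
  csum a l -> csum b m -> csum (fun n => Cplus (a n) (b n)) (Cplus l m).
Proof.
  intros [H1 H2] [H3 H4]. split.
  - exact (is_series_plus _ _ _ _ H1 H3).
  - exact (is_series_plus _ _ _ _ H2 H4).
Qed.

Lemma csum_scal (c : C) (a : nat -> C) (l : C) :
  csum a l -> csum (fun n => Cmult c (a n)) (Cmult c l).
Proof.
  intros [H1 H2]. split.
  - exact (is_series_minus _ _ _ _ (is_series_scal (Re c) _ _ H1) (is_series_scal (Im c) _ _ H2)).
  - exact (is_series_plus _ _ _ _ (is_series_scal (Re c) _ _ H2) (is_series_scal (Im c) _ _ H1)).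
Qed.

Lemma csum_decr_1 (a : nat -> C) (l : C) :
  csum (fun n => a (S n)) l -> csum a (Cplus (a 0%nat) l).
Proof.
  intros [H1 H2].
  assert (E : forall x y : R, plus (x + y) (opp x) = y)
    by (intros x y; unfold plus, opp; simpl; ring).
  split; apply is_series_decr_1.
  - exact (eq_ind_r (is_series _) H1 (E (Re (a 0%nat)) (Re l))).
  - exact (eq_ind_r (is_series _) H2 (E (Im (a 0%nat)) (Im l))).
Qed.

Lemma csum_real (a : nat -> R) (l : R) : is_series a l -> csum (fun n => RtoC (a n)) (RtoC l).
Proof.
  intros H. split; [exact H|]. simpl.
  pose proof (is_series_scal 0 _ _ H) as H0.
  apply (is_series_ext _ (fun _ => 0)) in H0; [|intros n; apply Rmult_0_l].
  change (scal 0 l) with (0 * l) in H0. now rewrite Rmult_0_l in H0.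
Qed.

Lemma im_le_Cmod (z : C) : Rabs (Im z) <= Cmod z.
Proof. eapply Rle_trans; [apply Rmax_r | apply Rmax_Cmod]. Qed.

Lemma csum_abs (a : nat -> C) (b : nat -> R) :
  (forall n, Cmod (a n) <= b n) -> ex_series b -> csum a (CSeries a).
Proof.
  intros H Hb. split; apply Series_correct;
    refine (ex_series_le (V := R_CompleteNormedModule) _ b _ Hb); intros n.
  - eapply Rle_trans; [apply re_le_Cmod | apply H].
  - eapply Rle_trans; [apply im_le_Cmod | apply H].
Qed.

Lemma Cmod_le_Re_Im (z : C) : Cmod z <= Rabs (Re z) + Rabs (Im z).
Proof.
  pose proof (Cmod2_alt z) as H.
  pose proof (Rabs_pos (Re z)). pose proof (Rabs_pos (Im z)).
  apply Rsqr_incr_0_var; [|lra].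
  unfold Rsqr. pose proof (pow2_abs (Re z)). pose proof (pow2_abs (Im z)). nra.
Qed.

Lemma Series_abs_le (a b : nat -> R) (l : R) :
  is_series a l -> (forall n, Rabs (a n) <= b n) -> ex_series b -> Rabs l <= Series b.
Proof.
  intros Ha H Hb. rewrite <- (is_series_unique _ _ Ha).
  assert (Hab : ex_series (fun n => Rabs (a n))).
  { refine (ex_series_le (V := R_CompleteNormedModule) _ b _ Hb); intros n.
    unfold norm; simpl. unfold abs; simpl. rewrite Rabs_Rabsolu. apply H. }
  eapply Rle_trans; [apply Series_Rabs, Hab|].
  apply Series_le; [|exact Hb]. intros n. split; [apply Rabs_pos | apply H].
Qed.

(** The factor 2 comes from bounding the two components separately; later uses only need some finite
    constant. *)
Lemma csum_bound (a : nat -> C) (b : nat -> R) (l : C) :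
  csum a l -> (forall n, Cmod (a n) <= b n) -> ex_series b -> Cmod l <= 2 * Series b.
Proof.
  intros [H1 H2] H Hb. eapply Rle_trans; [apply Cmod_le_Re_Im|].
  assert (Rabs (Re l) <= Series b).
  { apply (Series_abs_le _ _ _ H1); [|exact Hb].
    intros n. eapply Rle_trans; [apply re_le_Cmod | apply H]. }
  assert (Rabs (Im l) <= Series b).
  { apply (Series_abs_le _ _ _ H2); [|exact Hb].
    intros n. eapply Rle_trans; [apply im_le_Cmod | apply H]. }
  lra.
Qed.

Lemma is_series_single (k : nat) (x : R) :
  is_series (fun n => if Nat.eqb n k then x else 0) x.
Proof.
  unfold is_series. apply (filterlim_ext_loc (fun _ => x)); [|apply filterlim_const].
  exists k. intros n Hn. revert Hn.
  induction n as [|n IH]; intros Hn.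
  - replace k with 0%nat by lia. now rewrite sum_O.
  - rewrite sum_Sn. destruct (Nat.eq_dec k (S n)) as [->|Hk].
    + rewrite Nat.eqb_refl.
      assert (E : sum_n (fun m => if Nat.eqb m (S n) then x else 0) n = 0).
      { rewrite (sum_n_ext_loc _ (fun _ => 0)).
        - rewrite sum_n_const. apply Rmult_0_r.
        - intros m Hm. destruct (Nat.eqb_spec m (S n)); [lia|reflexivity]. }
      transitivity (0 + x); [symmetry; apply Rplus_0_l | exact (f_equal (fun y => y + x) (eq_sym E))].
    + destruct (Nat.eqb_spec (S n) k); [lia|].
      rewrite <- IH by lia. symmetry. apply Rplus_0_r.
Qed.

Lemma Series_nonneg (b : nat -> R) :
  (forall n, 0 <= b n) -> ex_series b -> 0 <= Series b.
Proof.
  intros Hb Hex.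
  apply Rle_trans with (Rabs 0); [rewrite Rabs_R0; lra|].
  apply (Series_abs_le (fun n => if Nat.eqb n 0 then 0 else 0));
    [apply (is_series_single 0%nat 0) | | exact Hex].
  intros n. destruct (Nat.eqb n 0); rewrite Rabs_R0; apply Hb.
Qed.

Lemma csum_single (k : nat) (x : C) :
  csum (fun n => if Nat.eqb n k then x else RtoC 0) x.
Proof.
  split.
  - apply is_series_ext with (fun n => if Nat.eqb n k then Re x else 0); [|apply is_series_single].
    intros n. now destruct (Nat.eqb n k).
  - apply is_series_ext with (fun n => if Nat.eqb n k then Im x else 0); [|apply is_series_single].
    intros n. now destruct (Nat.eqb n k).
Qed.

(** * The weights *)

Lemma wgt_pos (beta n : nat) : 0 < wgt beta n.
Proof.
  unfold wgt. apply Rdiv_lt_0_compat; [apply Rmult_lt_0_compat|]; apply INR_fact_lt_0.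
Qed.

Lemma wgt_0 (beta : nat) : wgt beta 0 = 1.
Proof.
  unfold wgt. change (INR (fact 0)) with 1. change (0 + beta + 1)%nat with (beta + 1)%nat.
  field. apply INR_fact_neq_0.
Qed.

(** Each factorial depending on [n] gains one factor from [n] to [S n]. Monotonicity of the weights,
    the ratio test and the moment recurrences all rest on this relation. *)
Lemma wgt_S (beta n : nat) :
  wgt beta (S n) * (INR n + INR beta + 2) = (INR n + 1) * wgt beta n.
Proof.
  unfold wgt. replace (S n + beta + 1)%nat with (S (n + beta + 1)) by lia.
  rewrite !fact_simpl, !mult_INR, !S_INR, !plus_INR. simpl (INR 1).
  pose proof (pos_INR n). pose proof (pos_INR beta).
  field. split; [apply INR_fact_neq_0 | lra].
Qed.

Lemma wgt_S_le (beta n : nat) : wgt beta (S n) <= wgt beta n.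
Proof.
  pose proof (wgt_S beta n). pose proof (wgt_pos beta n). pose proof (wgt_pos beta (S n)).
  pose proof (pos_INR n). pose proof (pos_INR beta). nra.
Qed.

Lemma wgt_le_1 (beta n : nat) : wgt beta n <= 1.
Proof.
  induction n as [|n IH]; [rewrite wgt_0; lra|].
  eapply Rle_trans; [apply wgt_S_le | exact IH].
Qed.

Lemma inv_wgt_S (beta n : nat) :
  (INR n + 1) * / wgt beta (S n) = (INR n + INR beta + 2) * / wgt beta n.
Proof.
  pose proof (wgt_S beta n) as H. pose proof (wgt_pos beta n). pose proof (wgt_pos beta (S n)).
  apply Rmult_eq_reg_r with (wgt beta n * wgt beta (S n)); [|nra].
  transitivity ((INR n + 1) * wgt beta n); [field; lra|]. rewrite <- H. field; lra.
Qed.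

Lemma is_lim_seq_shift_ratio (p : R) :
  is_lim_seq (fun n => (INR n + p) / (INR n + 1)) 1.
Proof.
  apply is_lim_seq_ext with (fun n => 1 + (p - 1) * / INR (S n)).
  { intros n. rewrite S_INR. pose proof (pos_INR n). field. lra. }
  replace (Finite 1) with (Finite (1 + (p - 1) * 0)) by (f_equal; ring).
  apply is_lim_seq_plus'; [apply is_lim_seq_const|].
  apply (is_lim_seq_scal_l _ (p - 1) 0).
  apply (is_lim_seq_incr_1 (fun n => / INR n)).
  replace (Finite 0) with (Rbar_inv p_infty) by reflexivity.
  apply is_lim_seq_inv; [apply is_lim_seq_INR | discriminate].
Qed.

(** The common dominating series: the factor [(INR n + 1) ^ 2] leaves room for values, derivatives,
    second order remainders and moments up to order 2. *)
Lemma ex_series_inv_wgt (beta : nat) (rho : R) :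
  0 < rho < 1 -> ex_series (fun n => (INR n + 1) ^ 2 * / wgt beta n * rho ^ n).
Proof.
  intros Hrho.
  assert (Hpos : forall n, 0 < (INR n + 1) ^ 2 * / wgt beta n * rho ^ n).
  { intros n. pose proof (pos_INR n). pose proof (Rinv_0_lt_compat _ (wgt_pos beta n)).
    pose proof (pow_lt rho n (proj1 Hrho)).
    apply Rmult_lt_0_compat; [apply Rmult_lt_0_compat; [apply pow_lt; lra|]|]; assumption. }
  apply ex_series_Rabs. apply ex_series_DAlembert with rho; [lra| |].
  { intros n. specialize (Hpos n). lra. }
  (* The ratio of consecutive terms: two factors from the square and one from [/ wgt], each tending
     to 1, times [rho]. *)
  apply is_lim_seq_ext with (fun n =>
    (INR n + 2) / (INR n + 1) * ((INR n + 2) / (INR n + 1)) *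
    ((INR n + (INR beta + 2)) / (INR n + 1)) * rho).
  { intros n. rewrite Rabs_pos_eq by (apply Rlt_le, Rdiv_lt_0_compat; apply Hpos).
    pose proof (inv_wgt_S beta n) as E. pose proof (pos_INR n).
    pose proof (wgt_pos beta n). pose proof (pow_lt rho n (proj1 Hrho)).
    replace (/ wgt beta (S n)) with ((INR n + (INR beta + 2)) / (INR n + 1) * / wgt beta n).
    2: { apply Rmult_eq_reg_l with (INR n + 1); [|lra]. rewrite E. field. lra. }
    rewrite S_INR. simpl pow. field. repeat split; lra. }
  replace (Finite rho) with (Finite (1 * 1 * 1 * rho)) by (f_equal; ring).
  apply is_lim_seq_mult'; [|apply is_lim_seq_const].
  repeat apply is_lim_seq_mult'; apply is_lim_seq_shift_ratio.
Qed.

(** * Point evaluation and derivative of a Taylor series *)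

Definition eval (f : nat -> C) (z : C) : C := CSeries (fun n => f n * z ^ n)%C.

(** At [n = 0] the factor [INR n] kills the term, so the convention [pred 0 = 0] is harmless. *)
Definition deval (f : nat -> C) (z : C) : C :=
  CSeries (fun n => f n * (RtoC (INR n) * z ^ (pred n)))%C.

(** The terms [w * x ^ 2] of a convergent series are bounded by some [M]; since [x <= 1 + x ^ 2] and
    [w <= 1], also [w * x <= 1 + M]. *)
Lemma inA2_bound (beta : nat) (f : nat -> C) :
  inA2 beta f -> exists M, 0 <= M /\ forall n, Cmod (f n) <= M * / wgt beta n.
Proof.
  intros Hf. apply ex_series_lim_0 in Hf.
  destruct (filterlim_bounded (K := R_AbsRing) (V := R_NormedModule)
    (fun n => wgt beta n * Cmod (f n) ^ 2)
    (ex_intro _ (0 : R_NormedModule) Hf)) as [M HM].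
  assert (HM0 : 0 <= M) by exact (Rle_trans _ _ _ (norm_ge_0 (V := R_NormedModule) _) (HM 0%nat)).
  exists (1 + M). split; [lra|]. intros n. specialize (HM n).
  assert (H : wgt beta n * Cmod (f n) ^ 2 <= M) by (eapply Rle_trans; [apply Rle_abs | exact HM]).
  pose proof (wgt_pos beta n) as Hw. pose proof (wgt_le_1 beta n) as Hw1.
  pose proof (Cmod_ge_0 (f n)).
  apply Rmult_le_reg_l with (wgt beta n); [exact Hw|].
  replace (wgt beta n * ((1 + M) * / wgt beta n)) with (1 + M) by (field; lra).
  pose proof (Rle_0_sqr (Cmod (f n) - 1)) as Hs. unfold Rsqr in Hs. nra.
Qed.

Lemma INR_pred_pow_le (n : nat) (x rho : R) :
  0 <= x <= rho -> 0 < rho -> INR n * x ^ pred n <= (INR n + 1) ^ 2 * rho ^ n * / rho.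
Proof.
  intros Hx Hrho. destruct n as [|n].
  - simpl. pose proof (Rinv_0_lt_compat _ Hrho). lra.
  - simpl pred. rewrite S_INR. replace ((INR n + 1 + 1) ^ 2 * rho ^ S n * / rho)
      with ((INR n + 1 + 1) ^ 2 * rho ^ n) by (simpl; field; lra).
    pose proof (pos_INR n). pose proof (pow_incr x rho n Hx).
    pose proof (pow_le x n (proj1 Hx)). nra.
Qed.

(** The remainders satisfy [R (S n) = z * R n + n * a ^ (n - 1) * (z - a) ^ 2], and
    [n ^ 2 + n <= (n + 1) ^ 2] closes the induction. The factor [rho ^ 2] on the left avoids the
    exponent [n - 2] on the right. *)
Lemma pow_taylor_bound (rho : R) (z a : C) (n : nat) :
  0 <= rho -> Cmod z <= rho -> Cmod a <= rho ->
  rho ^ 2 * Cmod (z ^ n - a ^ n - RtoC (INR n) * a ^ pred n * (z - a))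
  <= INR n ^ 2 * rho ^ n * Cmod (z - a) ^ 2.
Proof.
  intros Hrho Hz Ha. induction n as [|n IH].
  - simpl pred. simpl (INR 0). simpl Cpow.
    replace (1 - 1 - RtoC 0 * 1 * (z - a))%C with (RtoC 0) by ring.
    rewrite Cmod_0. simpl. lra.
  - assert (E : (z ^ S n - a ^ S n - RtoC (INR (S n)) * a ^ pred (S n) * (z - a))%C =
      (z * (z ^ n - a ^ n - RtoC (INR n) * a ^ pred n * (z - a)) +
       RtoC (INR n) * a ^ pred n * ((z - a) * (z - a)))%C).
    { rewrite S_INR, RtoC_plus. destruct n as [|n]; simpl pred; [simpl; ring|].
      rewrite !Cpow_S. ring. }
    rewrite E. set (d := Cmod (z - a)) in *.
    set (D := (z ^ n - a ^ n - _)%C) in *.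
    pose proof (Cmod_triangle (z * D) (RtoC (INR n) * a ^ pred n * ((z - a) * (z - a)))) as HT.
    rewrite !Cmod_mult, Cmod_pow, Cmod_R, Rabs_pos_eq in HT by apply pos_INR.
    fold d in HT.
    assert (Hd : 0 <= d) by apply Cmod_ge_0. pose proof (Cmod_ge_0 D) as HD.
    pose proof (pos_INR n) as Hn. pose proof (Cmod_ge_0 a) as Ha0.
    assert (Hp : rho ^ 2 * (INR n * Cmod a ^ pred n) <= INR n * rho ^ S n).
    { destruct n as [|n]; [simpl; lra|]. simpl pred.
      pose proof (pow_incr (Cmod a) rho n (conj Ha0 Ha)).
      replace (INR (S n) * rho ^ S (S n)) with (rho ^ 2 * (INR (S n) * rho ^ n)) by (simpl; ring).
      apply Rmult_le_compat_l; [apply pow2_ge_0|]. now apply Rmult_le_compat_l. }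
    assert (HpD : rho ^ 2 * (Cmod z * Cmod D) <= INR n ^ 2 * rho ^ S n * d ^ 2).
    { replace (rho ^ 2 * (Cmod z * Cmod D)) with (Cmod z * (rho ^ 2 * Cmod D)) by ring.
      replace (INR n ^ 2 * rho ^ S n * d ^ 2) with (rho * (INR n ^ 2 * rho ^ n * d ^ 2)) by (simpl; ring).
      apply Rmult_le_compat; [apply Cmod_ge_0 | | exact Hz | exact IH].
      apply Rmult_le_pos; [apply pow2_ge_0 | exact HD]. }
    apply Rle_trans with (rho ^ 2 * (Cmod z * Cmod D + INR n * Cmod a ^ pred n * (d * d))).
    { apply Rmult_le_compat_l; [apply pow2_ge_0 | exact HT]. }
    assert (Hq : rho ^ 2 * (INR n * Cmod a ^ pred n) * d ^ 2 <= INR n * rho ^ S n * d ^ 2).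
    { apply Rmult_le_compat_r; [apply pow2_ge_0 | exact Hp]. }
    rewrite S_INR.
    assert (Hr : 0 <= rho ^ S n * d ^ 2) by (apply Rmult_le_pos; [apply pow_le | apply pow2_ge_0]; lra).
    replace (rho ^ 2 * (Cmod z * Cmod D + INR n * Cmod a ^ pred n * (d * d)))
      with (rho ^ 2 * (Cmod z * Cmod D) + rho ^ 2 * (INR n * Cmod a ^ pred n) * d ^ 2) by ring.
    nra.
Qed.

Section Evaluation.

Variables (beta : nat) (f : nat -> C).
Hypothesis Hf : inA2 beta f.

Lemma csum_eval (z : C) : Cmod z < 1 -> csum (fun n => f n * z ^ n)%C (eval f z).
Proof.
  intros Hz. destruct (inA2_bound _ _ Hf) as (M & HM0 & HM).
  pose proof (Cmod_ge_0 z). set (rho := (Cmod z + 1) / 2).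
  assert (Hrho : 0 < rho < 1) by (unfold rho; lra).
  apply csum_abs with (fun n => M * ((INR n + 1) ^ 2 * / wgt beta n * rho ^ n)).
  2: exact (ex_series_scal M _ (ex_series_inv_wgt beta rho Hrho)).
  intros n. rewrite Cmod_mult, Cmod_pow.
  assert (Hp : Cmod z ^ n <= rho ^ n) by (apply pow_incr; unfold rho; lra).
  pose proof (pow_le _ n H). pose proof (Cmod_ge_0 (f n)).
  pose proof (Rinv_0_lt_compat _ (wgt_pos beta n)) as Hw. pose proof (pos_INR n).
  apply Rle_trans with (M * / wgt beta n * rho ^ n).
  - apply Rmult_le_compat; auto.
  - replace (M * ((INR n + 1) ^ 2 * / wgt beta n * rho ^ n))
      with ((INR n + 1) ^ 2 * (M * / wgt beta n * rho ^ n)) by ring.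
    assert (0 <= M * / wgt beta n * rho ^ n) by (repeat apply Rmult_le_pos; lra).
    nra.
Qed.

Lemma csum_deval (z : C) :
  Cmod z < 1 -> csum (fun n => f n * (RtoC (INR n) * z ^ pred n))%C (deval f z).
Proof.
  intros Hz. destruct (inA2_bound _ _ Hf) as (M & HM0 & HM).
  pose proof (Cmod_ge_0 z). set (rho := (Cmod z + 1) / 2).
  assert (Hrho : 0 < rho < 1) by (unfold rho; lra).
  apply csum_abs with (fun n => M / rho * ((INR n + 1) ^ 2 * / wgt beta n * rho ^ n)).
  2: exact (ex_series_scal (M / rho) _ (ex_series_inv_wgt beta rho Hrho)).
  intros n. rewrite !Cmod_mult, Cmod_pow, Cmod_R, Rabs_pos_eq by apply pos_INR.
  replace (M / rho * ((INR n + 1) ^ 2 * / wgt beta n * rho ^ n))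
    with (M * / wgt beta n * ((INR n + 1) ^ 2 * rho ^ n * / rho)) by (unfold Rdiv; ring).
  apply Rmult_le_compat; auto using Cmod_ge_0.
  - apply Rmult_le_pos; [apply pos_INR | apply pow_le, H].
  - apply INR_pred_pow_le; unfold rho; lra.
Qed.

Lemma eval_taylor_bound (rho : R) :
  0 < rho < 1 -> exists M, 0 <= M /\ forall z a, Cmod z <= rho -> Cmod a <= rho ->
  Cmod (eval f z - eval f a - deval f a * (z - a)) <= M * Cmod (z - a) ^ 2.
Proof.
  intros Hrho. destruct (inA2_bound _ _ Hf) as (M & HM0 & HM).
  pose proof (ex_series_inv_wgt beta rho Hrho) as Hex.
  set (b := fun n => (INR n + 1) ^ 2 * / wgt beta n * rho ^ n) in *.
  assert (Hb : forall n, 0 <= b n).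
  { intros n. unfold b. pose proof (Rinv_0_lt_compat _ (wgt_pos beta n)).
    pose proof (pow_lt rho n (proj1 Hrho)).
    apply Rmult_le_pos; [apply Rmult_le_pos; [apply pow2_ge_0|]|]; lra. }
  pose proof (Series_nonneg b Hb Hex) as HS.
  assert (Hr2 : 0 < / rho ^ 2) by (apply Rinv_0_lt_compat, pow_lt; lra).
  (* The 2 is that of [csum_bound], [M] bounds the coefficients, and [/ rho ^ 2] undoes the factor
     in [pow_taylor_bound]. *)
  exists (2 * (M * / rho ^ 2) * Series b). split.
  { repeat apply Rmult_le_pos; lra. }
  intros z a Hz Ha. set (d := Cmod (z - a)).
  assert (Hsum : csum (fun n => f n * (z ^ n - a ^ n - RtoC (INR n) * a ^ pred n * (z - a)))%C
    (eval f z - eval f a - deval f a * (z - a))%C).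
  { replace (fun n => f n * (z ^ n - a ^ n - RtoC (INR n) * a ^ pred n * (z - a)))%C with
      (fun n => f n * z ^ n + (- (1) * (f n * a ^ n) + - (z - a) * (f n * (RtoC (INR n) * a ^ pred n))))%C
      by (apply functional_extensionality; intros n; ring).
    replace (eval f z - eval f a - deval f a * (z - a))%C with
      (eval f z + (- (1) * eval f a + - (z - a) * deval f a))%C by ring.
    apply csum_plus; [apply csum_eval; lra|].
    apply csum_plus; apply csum_scal; [apply csum_eval | apply csum_deval]; lra. }
  replace (2 * (M * / rho ^ 2) * Series b * d ^ 2)
    with (2 * Series (fun n => (M * / rho ^ 2 * d ^ 2) * b n)) by (rewrite Series_scal_l; ring).
  apply (csum_bound _ _ _ Hsum).
  2: exact (ex_series_scal (M * / rho ^ 2 * d ^ 2) _ Hex).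
  intros n. rewrite Cmod_mult.
  assert (Hrho0 : 0 <= rho) by lra.
  pose proof (pow_taylor_bound rho z a n Hrho0 Hz Ha) as HT. fold d in HT.
  set (D := Cmod (z ^ n - a ^ n - _)) in *.
  assert (HD : D <= / rho ^ 2 * ((INR n + 1) ^ 2 * rho ^ n * d ^ 2)).
  { apply Rmult_le_reg_l with (rho ^ 2); [apply pow_lt; lra|].
    replace (rho ^ 2 * (/ rho ^ 2 * ((INR n + 1) ^ 2 * rho ^ n * d ^ 2)))
      with ((INR n + 1) ^ 2 * rho ^ n * d ^ 2) by (field; lra).
    eapply Rle_trans; [exact HT|].
    apply Rmult_le_compat_r; [apply pow2_ge_0|].
    apply Rmult_le_compat_r; [apply pow_le; lra|]. pose proof (pos_INR n). nra. }
  replace (M * / rho ^ 2 * d ^ 2 * b n)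
    with (M * / wgt beta n * (/ rho ^ 2 * ((INR n + 1) ^ 2 * rho ^ n * d ^ 2))) by (unfold b; ring).
  apply Rmult_le_compat; auto using Cmod_ge_0. apply Cmod_ge_0.
Qed.

End Evaluation.

(** * Uniqueness of Taylor coefficients *)

Lemma ex_series_PSeries_radius (a : nat -> R) :
  ex_series (fun n => Rabs (a n * (/ 2) ^ n)) -> Rbar_lt 0 (CV_radius a).
Proof.
  intros H. apply Rbar_lt_le_trans with (/ 2); [simpl; lra|].
  exact (proj1 (Lub.Lub_Rbar_correct (CV_disk a)) (/ 2) H).
Qed.

(** On the real segment the components of [eval f] are real power series with coefficients
    [Re (f n)] and [Im (f n)]. Absolute convergence at 1/2 makes their radii positive, so the
    identity theorem for real power series applies. *)
Lemma eval_inj (beta : nat) (f g : nat -> C) :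
  inA2 beta f -> inA2 beta g ->
  (forall z, Cmod z < 1 -> eval f z = eval g z) -> forall n, f n = g n.
Proof.
  intros Hf Hg H n.
  assert (Habs : forall h, inA2 beta h ->
    ex_series (fun n => Rabs (Re (h n) * (/ 2) ^ n)) /\
    ex_series (fun n => Rabs (Im (h n) * (/ 2) ^ n))).
  { intros h Hh. destruct (inA2_bound _ _ Hh) as (M & HM0 & HM).
    assert (Hhalf : 0 < / 2 < 1) by lra.
    pose proof (ex_series_scal M _ (ex_series_inv_wgt beta (/ 2) Hhalf)) as Hex.
    assert (Hle : forall x n, Rabs x <= Cmod (h n) ->
      Rabs (Rabs (x * (/ 2) ^ n)) <= M * ((INR n + 1) ^ 2 * / wgt beta n * (/ 2) ^ n)).
    { intros x k Hx. rewrite Rabs_Rabsolu, Rabs_mult.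
      pose proof (pow_lt (/ 2) k (proj1 Hhalf)) as Hp. rewrite (Rabs_pos_eq ((/ 2) ^ k)) by lra.
      replace (M * ((INR k + 1) ^ 2 * / wgt beta k * (/ 2) ^ k))
        with ((INR k + 1) ^ 2 * (M * / wgt beta k) * (/ 2) ^ k) by ring.
      apply Rmult_le_compat_r; [lra|].
      pose proof (Rinv_0_lt_compat _ (wgt_pos beta k)). pose proof (pos_INR k).
      assert (0 <= M * / wgt beta k) by (apply Rmult_le_pos; lra).
      specialize (HM k). nra. }
    split; refine (ex_series_le (V := R_CompleteNormedModule) _ _ _ Hex); intros k;
      apply Hle; [apply re_le_Cmod | apply im_le_Cmod]. }
  destruct (Habs f Hf) as [Hf1 Hf2]. destruct (Habs g Hg) as [Hg1 Hg2].
  assert (Hreal : forall h x, Rabs x < 1 -> eval h (RtoC x) =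
    (PSeries (fun n => Re (h n)) x, PSeries (fun n => Im (h n)) x)).
  { intros h x Hx. unfold eval, CSeries, PSeries.
    f_equal; apply Series_ext; intros k; rewrite <- RtoC_pow; unfold Re, Im, Cmult, RtoC; cbn [fst snd]; ring. }
  assert (Hloc : locally 0 (fun x => Rabs x < 1)).
  { exists (mkposreal 1 Rlt_0_1). intros x Hx.
    unfold ball in Hx; simpl in Hx; unfold AbsRing_ball, abs, minus, plus, opp in Hx; simpl in Hx.
    now rewrite Ropp_0, Rplus_0_r in Hx. }
  assert (Heq : forall x, Rabs x < 1 ->
    PSeries (fun n => Re (f n)) x = PSeries (fun n => Re (g n)) x /\
    PSeries (fun n => Im (f n)) x = PSeries (fun n => Im (g n)) x).
  { intros x Hx. pose proof (H (RtoC x)) as E. rewrite Cmod_R, !Hreal in E by exact Hx.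
    specialize (E Hx). split; [exact (f_equal fst E) | exact (f_equal snd E)]. }
  assert (E1 : Re (f n) = Re (g n)).
  { apply (PSeries_ext_recip (fun n => Re (f n)) (fun n => Re (g n)) n).
    1,2: now apply ex_series_PSeries_radius.
    revert Hloc. apply filter_imp. intros x Hx. now apply Heq. }
  assert (E2 : Im (f n) = Im (g n)).
  { apply (PSeries_ext_recip (fun n => Im (f n)) (fun n => Im (g n)) n).
    1,2: now apply ex_series_PSeries_radius.
    revert Hloc. apply filter_imp. intros x Hx. now apply Heq. }
  destruct (f n), (g n); simpl in *; now subst.
Qed.

(** * The involution [phi_a] *)

Lemma Cconj_R (x : R) : Cconj (RtoC x) = RtoC x.
Proof. unfold Cconj, RtoC. simpl. now rewrite Ropp_0. Qed.

Lemma Cmult_eq_reg_l (c x y : C) : (c * x)%C = (c * y)%C -> c <> RtoC 0 -> x = y.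
Proof.
  intros H Hc. rewrite <- (Cmult_1_l x), <- (Cmult_1_l y), <- (Cinv_l c Hc), <- !Cmult_assoc.
  now rewrite H.
Qed.

Lemma one_minus_conj_mul_bound (a y : C) :
  Cmod y <= 1 -> 1 - Cmod a <= Cmod (1 - Cconj a * y).
Proof.
  intros Hy. pose proof (Cmod_triangle (1 - Cconj a * y) (Cconj a * y)) as H.
  replace (1 - Cconj a * y + Cconj a * y)%C with (RtoC 1) in H by ring.
  rewrite Cmod_1, Cmod_mult, Cmod_conj in H. pose proof (Cmod_ge_0 a). nra.
Qed.

Lemma one_minus_conj_mul_neq_0 (a y : C) :
  Cmod a < 1 -> Cmod y <= 1 -> (1 - Cconj a * y)%C <> RtoC 0.
Proof.
  intros Ha Hy. apply Cmod_gt_0. pose proof (one_minus_conj_mul_bound a y Hy). lra.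
Qed.

Lemma one_minus_conj_self (a : C) : (1 - Cconj a * a)%C = RtoC (1 - Cmod a ^ 2).
Proof. rewrite RtoC_minus, Cmod2_conj. ring. Qed.

Lemma phi_a_0 (a : C) : phi_a a 0 = a.
Proof. unfold phi_a. field. Qed.

Lemma phi_a_invol (a z : C) : Cmod a < 1 -> Cmod z < 1 -> phi_a a (phi_a a z) = z.
Proof.
  intros Ha Hz. unfold phi_a.
  assert (H1 : (1 - Cconj a * z)%C <> RtoC 0) by (apply one_minus_conj_mul_neq_0; lra).
  assert (H2 : (1 - Cconj a * a)%C <> RtoC 0) by (apply one_minus_conj_mul_neq_0; lra).
  field. split; [exact H1|].
  replace (1 - Cconj a * z - Cconj a * (a - z))%C with (1 - Cconj a * a)%C by ring. exact H2.
Qed.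

Lemma phi_a_sub (a y : C) : Cmod a < 1 -> Cmod y < 1 ->
  (phi_a a y - a = - ((1 - Cconj a * a) * y / (1 - Cconj a * y)))%C.
Proof.
  intros Ha Hy. unfold phi_a. field. apply one_minus_conj_mul_neq_0; lra.
Qed.

(** The Schwarz-Pick identity; its product form both keeps [phi_a a y] inside the disc and measures
    its distance from the circle. *)
Lemma Cmod2_phi_a (a y : C) : Cmod a < 1 -> Cmod y < 1 ->
  1 - Cmod (phi_a a y) ^ 2
  = (1 - Cmod a ^ 2) * (1 - Cmod y ^ 2) / Cmod (1 - Cconj a * y) ^ 2.
Proof.
  intros Ha Hy.
  assert (H1 : (1 - Cconj a * y)%C <> RtoC 0) by (apply one_minus_conj_mul_neq_0; lra).
  unfold phi_a. rewrite Cmod_div by exact H1.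
  apply Cmod_gt_0 in H1.
  assert (E : Cmod (1 - Cconj a * y) ^ 2 - Cmod (a - y) ^ 2 = (1 - Cmod a ^ 2) * (1 - Cmod y ^ 2)).
  { rewrite !Cmod2_alt. destruct a, y. simpl. ring. }
  rewrite <- E. field. lra.
Qed.

Lemma Cmod_phi_a_lt_1 (a y : C) : Cmod a < 1 -> Cmod y < 1 -> Cmod (phi_a a y) < 1.
Proof.
  intros Ha Hy. pose proof (Cmod2_phi_a a y Ha Hy) as E.
  pose proof (Cmod_ge_0 a). pose proof (Cmod_ge_0 y). pose proof (Cmod_ge_0 (phi_a a y)).
  assert (H2 : 0 < Cmod (1 - Cconj a * y)) by (apply Cmod_gt_0, one_minus_conj_mul_neq_0; lra).
  assert (0 < 1 - Cmod (phi_a a y) ^ 2).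
  { rewrite E. apply Rdiv_lt_0_compat; [apply Rmult_lt_0_compat; nra | nra]. }
  nra.
Qed.

Lemma Cmod_phi_a_le (a : C) (sigma : R) : Cmod a < 1 -> 0 <= sigma < 1 ->
  exists rho, 0 < rho < 1 /\ forall y, Cmod y <= sigma -> Cmod (phi_a a y) <= rho.
Proof.
  intros Ha Hs. pose proof (Cmod_ge_0 a).
  (* A lower bound for [1 - Cmod (phi_a a y) ^ 2]; the 4 bounds the squared denominator, as
     [Cmod (1 - Cconj a * y) <= 2]. *)
  set (t := (1 - Cmod a ^ 2) * (1 - sigma ^ 2) / 4).
  assert (HA : 0 < 1 - Cmod a ^ 2 <= 1) by (split; nra).
  assert (HB : 0 < 1 - sigma ^ 2 <= 1) by (split; nra).
  assert (Ht : 0 < t < 1) by (unfold t; split; nra).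
  exists (sqrt (1 - t)). split.
  { split; [apply sqrt_lt_R0; lra|]. rewrite <- sqrt_1 at 2. apply sqrt_lt_1; lra. }
  intros y Hy. pose proof (Cmod_ge_0 y).
  apply Rsqr_incr_0_var; [|apply sqrt_pos]. rewrite Rsqr_sqrt by lra.
  assert (Hy1 : Cmod y < 1) by lra.
  pose proof (Cmod2_phi_a a y Ha Hy1) as E.
  assert (H2 : 0 < Cmod (1 - Cconj a * y)) by (apply Cmod_gt_0, one_minus_conj_mul_neq_0; lra).
  assert (H3 : Cmod (1 - Cconj a * y) <= 2).
  { eapply Rle_trans; [apply Cmod_triangle|].
    rewrite Cmod_1, Cmod_opp, Cmod_mult, Cmod_conj. nra. }
  assert (Ht2 : t <= 1 - Cmod (phi_a a y) ^ 2).
  { rewrite E. unfold t, Rdiv. apply Rmult_le_compat.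
    - apply Rmult_le_pos; nra.
    - lra.
    - apply Rmult_le_compat_l; nra.
    - apply Rinv_le_contravar; nra. }
  unfold Rsqr. nra.
Qed.

(** A first order expansion at [a] in the coordinate [y], in which the symbol of the composition
    operator will be multiplication by [lambda]. The plus sign appears because [phi_a a] has
    derivative [-(1 - Cconj a * a)] at 0. *)
Lemma eval_phi_a_expansion (beta : nat) (f : nat -> C) (a : C) (sigma : R) :
  inA2 beta f -> Cmod a < 1 -> 0 <= sigma < 1 ->
  exists M, 0 <= M /\ forall y, Cmod y <= sigma ->
  Cmod (eval f (phi_a a y) - eval f a + (1 - Cconj a * a) * y * deval f a) <= M * Cmod y ^ 2.
Proof.
  intros Hf Ha Hs. destruct (Cmod_phi_a_le a sigma Ha Hs) as (rho & Hrho & Hle).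
  destruct (eval_taylor_bound beta f Hf rho Hrho) as (M & HM0 & HM).
  set (delta := 1 - Cmod a). assert (Hdelta : 0 < delta) by (unfold delta; lra).
  pose proof (Cmod_ge_0 (deval f a)) as Hdf. pose proof (Cmod_ge_0 a) as Ha0.
  pose proof (Rinv_0_lt_compat _ Hdelta) as Hdi.
  (* The first summand pays for the Taylor remainder of [f], using
     [Cmod (phi_a a y - a) <= Cmod y / delta]; the second for the linearisation of [phi_a a] at
     0. *)
  exists (M * (/ delta) ^ 2 + Cmod (deval f a) * / delta). split.
  { apply Rplus_le_le_0_compat; apply Rmult_le_pos; try lra. apply pow2_ge_0. }
  intros y Hy. pose proof (Cmod_ge_0 y) as Hy0.
  assert (Hy1 : Cmod y < 1) by lra.
  set (D := (1 - Cconj a * y)%C).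
  assert (HD0 : D <> RtoC 0) by (apply one_minus_conj_mul_neq_0; lra).
  assert (HD : / Cmod D <= / delta).
  { apply Rinv_le_contravar; [exact Hdelta|]. apply one_minus_conj_mul_bound. lra. }
  assert (HDp : 0 < / Cmod D) by (apply Rinv_0_lt_compat, Cmod_gt_0, HD0).
  assert (Hq : Cmod (1 - Cconj a * a) <= 1).
  { rewrite one_minus_conj_self, Cmod_R, Rabs_pos_eq; nra. }
  pose proof (Cmod_ge_0 (1 - Cconj a * a)) as Hq0.
  set (q := (1 - Cconj a * a)%C) in *.
  assert (Ha_rho : Cmod a <= rho).
  { rewrite <- (phi_a_0 a) at 1. apply Hle. rewrite Cmod_0. lra. }
  pose proof (HM (phi_a a y) a (Hle y Hy) Ha_rho) as HT.
  rewrite (phi_a_sub a y Ha Hy1) in HT. fold q D in HT.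
  replace (eval f (phi_a a y) - eval f a + q * y * deval f a)%C with
    (eval f (phi_a a y) - eval f a - deval f a * - (q * y / D)
     + deval f a * (- (q * y * (Cconj a * y) / D)))%C
    by (unfold D; field; exact HD0).
  eapply Rle_trans; [apply Cmod_triangle|].
  rewrite Rmult_plus_distr_r. apply Rplus_le_compat.
  - eapply Rle_trans; [exact HT|]. rewrite Rmult_assoc. apply Rmult_le_compat_l; [exact HM0|].
    rewrite <- Rpow_mult_distr. apply pow_incr. split; [apply Cmod_ge_0|].
    rewrite Cmod_opp. unfold Cdiv. rewrite !Cmod_mult, Cmod_inv by exact HD0.
    rewrite (Rmult_comm (/ delta)). apply Rmult_le_compat; nra.
  - rewrite Cmod_mult, Cmod_opp, Rmult_assoc. apply Rmult_le_compat_l; [exact Hdf|].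
    unfold Cdiv. rewrite !Cmod_mult, Cmod_conj, Cmod_inv by exact HD0.
    rewrite (Rmult_comm (/ delta)). apply Rmult_le_compat; [|lra| |exact HD].
    + repeat apply Rmult_le_pos; lra.
    + replace (Cmod q * Cmod y * (Cmod a * Cmod y)) with ((Cmod q * Cmod a) * Cmod y ^ 2) by ring.
      rewrite <- (Rmult_1_l (Cmod y ^ 2)) at 2.
      apply Rmult_le_compat_r; [apply pow2_ge_0|]. nra.
Qed.

(** The form in which limits at the fixed point are taken below, along [lambda ^ k * u] or along
    powers of 1/2. *)
Lemma Cmod_le_pow_eq_0 (c : C) (M t : R) :
  0 <= t < 1 -> (forall k, Cmod c <= M * t ^ k) -> c = RtoC 0.
Proof.
  intros Ht H. apply Cmod_eq_0.
  assert (Hl : is_lim_seq (fun k => M * t ^ k) 0).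
  { replace (Finite 0) with (Rbar_mult M 0) by (simpl; f_equal; ring).
    apply is_lim_seq_scal_l, is_lim_seq_geom. rewrite Rabs_pos_eq; lra. }
  pose proof (is_lim_seq_le _ _ (Cmod c) 0 H (is_lim_seq_const _) Hl) as Hle. simpl in Hle.
  pose proof (Cmod_ge_0 c). lra.
Qed.

(** * The composition operator at its fixed point, and its eigenvectors for 1 and [lambda] *)

Section CompositionOperator.

Variables (beta : nat) (alpha lambda : C) (T : (nat -> C) -> nat -> C).
Hypothesis Halpha : Cmod alpha < 1.
Hypothesis Hlambda : 0 < Cmod lambda < 1.
Hypothesis HT : is_comp_op beta (fun z => phi_a alpha (Cmult lambda (phi_a alpha z))) T.

Let q := (1 - Cconj alpha * alpha)%C.

Lemma q_neq_0 : q <> RtoC 0.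
Proof. apply one_minus_conj_mul_neq_0; lra. Qed.

Lemma Cmod_mult_lambda (u : C) : Cmod u < 1 -> Cmod (lambda * u) < 1.
Proof. intros Hu. rewrite Cmod_mult. pose proof (Cmod_ge_0 u). nra. Qed.

Lemma Cmod_pow_lambda (u : C) (k : nat) : Cmod (lambda ^ k * u) <= Cmod u.
Proof.
  rewrite Cmod_mult, Cmod_pow. pose proof (Cmod_ge_0 u).
  assert (Hk : Cmod lambda ^ k <= 1 ^ k) by (apply pow_incr; lra). rewrite pow1 in Hk.
  assert (0 <= Cmod lambda ^ k) by (apply pow_le; lra). nra.
Qed.

(** Since [phi_a alpha] is an involution, writing points as [phi_a alpha u] turns the symbol into
    [u -> lambda * u]. *)
Lemma eval_comp_op (f : nat -> C) (u : C) : inA2 beta f -> Cmod u < 1 ->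
  eval (T f) (phi_a alpha u) = eval f (phi_a alpha (lambda * u)).
Proof.
  intros Hf Hu. destruct (HT f Hf) as [HTf Hc].
  assert (Hb : forall h z l, psum_to h z l <-> csum (fun n => h n * z ^ n)%C l).
  { (* [cpow] is convertible to Coquelicot's [Cpow]. *)
    intros h z l. exact (is_series_csum (fun n => h n * z ^ n)%C l). }
  pose proof (Cmod_phi_a_lt_1 _ _ Halpha Hu) as Hz.
  pose proof (Cmod_phi_a_lt_1 _ _ Halpha (Cmod_mult_lambda u Hu)) as Hz'.
  specialize (Hc _ Hz (eval f (phi_a alpha (lambda * u)))).
  rewrite phi_a_invol in Hc by assumption. rewrite !Hb in Hc.
  exact (csum_unique _ _ _ (csum_eval beta _ HTf _ Hz) (Hc (csum_eval beta _ Hf _ Hz'))).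
Qed.

Lemma eval_comp_op_fixpoint (f : nat -> C) : inA2 beta f -> eval (T f) alpha = eval f alpha.
Proof.
  intros Hf. pose proof (eval_comp_op f (RtoC 0) Hf) as H.
  replace (lambda * RtoC 0)%C with (RtoC 0) in H by ring.
  rewrite phi_a_0, Cmod_0 in H. apply H. lra.
Qed.

(** The chain rule at [alpha], got by comparing the expansion of [T f] at [y] with that of [f] at
    [lambda * y]. Values and constant terms agree, so [y] times the difference of the linear
    coefficients is quadratically small in [y]. *)
Lemma deval_comp_op_fixpoint (f : nat -> C) :
  inA2 beta f -> deval (T f) alpha = (lambda * deval f alpha)%C.
Proof.
  intros Hf. destruct (HT f Hf) as [HTf _].
  assert (Hhalf : 0 <= / 2 < 1) by lra.
  destruct (eval_phi_a_expansion _ _ _ _ Hf Halpha Hhalf) as (M & HM0 & HM).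
  destruct (eval_phi_a_expansion _ _ _ _ HTf Halpha Hhalf) as (M' & HM0' & HM').
  fold q in HM, HM'.
  assert (E : (q * (deval (T f) alpha - lambda * deval f alpha))%C = RtoC 0).
  { apply (Cmod_le_pow_eq_0 _ (M + M') (/ 2) Hhalf). intros k.
    (* The exponent [S k] keeps [y] within radius 1/2 even for [k = 0]. *)
    set (y := RtoC ((/ 2) ^ S k)).
    assert (Hyp : 0 < (/ 2) ^ S k) by (apply pow_lt; lra).
    assert (Hk : (/ 2) ^ k <= 1 ^ k) by (apply pow_incr; lra). rewrite pow1 in Hk.
    assert (Hy : Cmod y = (/ 2) ^ S k) by (unfold y; rewrite Cmod_R; apply Rabs_pos_eq; lra).
    assert (Hy2 : Cmod y <= / 2) by (rewrite Hy; simpl; lra).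
    assert (Hy3 : Cmod (lambda * y) <= Cmod y) by (rewrite Cmod_mult; nra).
    assert (Hy4 : Cmod (lambda * y) <= / 2) by lra.
    pose proof (HM _ Hy4) as B1. pose proof (HM' y Hy2) as B2.
    rewrite eval_comp_op, eval_comp_op_fixpoint in B2 by (assumption || lra).
    set (X := (_ + _)%C) in B1. set (Y := (_ + _)%C) in B2.
    assert (EXY : (y * (q * (deval (T f) alpha - lambda * deval f alpha)) = Y + - X)%C)
      by (unfold X, Y; ring).
    pose proof (Cmod_triangle Y (- X)) as HXY. rewrite <- EXY, Cmod_opp, Cmod_mult in HXY.
    assert (Hsq : Cmod (lambda * y) ^ 2 <= Cmod y ^ 2)
      by (apply pow_incr; split; [apply Cmod_ge_0 | exact Hy3]).
    set (c := Cmod (q * _)) in *. rewrite Hy in *.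
    apply Rmult_le_reg_l with ((/ 2) ^ S k); [exact Hyp|].
    apply Rle_trans with ((M + M') * ((/ 2) ^ S k) ^ 2).
    - nra.
    - assert ((/ 2) ^ S k <= (/ 2) ^ k) by (simpl in *; lra).
      replace ((/ 2) ^ S k * ((M + M') * (/ 2) ^ k)) with ((M + M') * ((/ 2) ^ S k * (/ 2) ^ k)) by ring.
      apply Rmult_le_compat_l; [lra|].
      rewrite <- Rsqr_pow2. now apply Rmult_le_compat_l; [apply Rlt_le|]. }
  apply Ceq_minus, (Cmult_eq_reg_l q); [|exact q_neq_0]. rewrite E. ring.
Qed.

Lemma eval_iterate (g : nat -> C) (mu u : C) (k : nat) :
  inA2 beta g -> (forall n, T g n = Cmult mu (g n)) -> Cmod u < 1 ->
  eval g (phi_a alpha (lambda ^ k * u)) = (mu ^ k * eval g (phi_a alpha u))%C.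
Proof.
  intros Hg HTg Hu.
  assert (Hstep : forall w, Cmod w < 1 ->
    eval g (phi_a alpha (lambda * w)) = (mu * eval g (phi_a alpha w))%C).
  { intros w Hw. rewrite <- eval_comp_op by assumption. unfold eval at 1.
    apply csum_CSeries.
    replace (fun n => T g n * phi_a alpha w ^ n)%C with (fun n => mu * (g n * phi_a alpha w ^ n))%C.
    - apply csum_scal, (csum_eval beta); [exact Hg|]. now apply Cmod_phi_a_lt_1.
    - apply functional_extensionality; intros n. rewrite HTg. ring. }
  induction k as [|k IH].
  - simpl. now rewrite !Cmult_1_l.
  - rewrite !Cpow_S. rewrite <- !Cmult_assoc, Hstep, IH; [ring|].
    eapply Rle_lt_trans; [apply Cmod_pow_lambda | exact Hu].
Qed.

(** The value of [g] is the same at all points [phi_a alpha (lambda ^ k * u)], and these tend to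
    [alpha]. *)
Lemma eigenvector_1_constant (g : nat -> C) :
  inA2 beta g -> (forall n, T g n = g n) ->
  forall z, Cmod z < 1 -> eval g z = eval g alpha.
Proof.
  intros Hg HTg z Hz. rewrite <- (phi_a_invol alpha z Halpha Hz) at 1.
  set (u := phi_a alpha z). assert (Hu : Cmod u < 1) by now apply Cmod_phi_a_lt_1.
  (* With [sigma = Cmod u] a single constant serves all the iterates [lambda ^ k * u]. *)
  destruct (eval_phi_a_expansion _ _ _ _ Hg Halpha (conj (Cmod_ge_0 u) Hu)) as (M & HM0 & HM).
  fold q in HM. set (d := (q * u * deval g alpha)%C).
  assert (E : (eval g (phi_a alpha u) - eval g alpha)%C = RtoC 0).
  { assert (Hl : 0 <= Cmod lambda < 1) by lra.
    apply (Cmod_le_pow_eq_0 _ (M + Cmod d) (Cmod lambda) Hl). intros k.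
    pose proof (HM _ (Cmod_pow_lambda u k)) as B.
    assert (HTg' : forall n, T g n = (1 * g n)%C) by (intros n; rewrite HTg; ring).
    rewrite (eval_iterate g (RtoC 1)) in B by assumption.
    rewrite Cpow_1_l, Cmult_1_l in B.
    set (X := (_ + _)%C) in B.
    replace (eval g (phi_a alpha u) - eval g alpha)%C with (X + - (lambda ^ k * d))%C
      by (unfold X, d; ring).
    eapply Rle_trans; [apply Cmod_triangle|].
    rewrite Cmod_opp, Cmod_mult, Cmod_pow.
    set (t := Cmod lambda ^ k).
    assert (Ht0 : 0 <= t) by (apply pow_le; lra).
    assert (Ht1 : t <= 1) by (unfold t; rewrite <- (pow1 k); apply pow_incr; lra).
    assert (HB : Cmod (lambda ^ k * u) ^ 2 <= t).
    { rewrite Cmod_mult, Cmod_pow. fold t. pose proof (Cmod_ge_0 u).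
      assert (0 <= t * Cmod u <= t) by nra. nra. }
    nra. }
  replace (eval g (phi_a alpha u)) with (eval g (phi_a alpha u) - eval g alpha + eval g alpha)%C by ring.
  rewrite E. ring.
Qed.

(** First [g] vanishes at [alpha], as [Cmod lambda < 1]. Along the iterates both the value and the
    linear term then carry the factor [lambda ^ k], while the remainder is of size
    [Cmod lambda ^ (2 * k)]; dividing by [lambda ^ k] leaves only the linear term in the limit. *)
Lemma eigenvector_lambda_multiple (g : nat -> C) :
  inA2 beta g -> (forall n, T g n = Cmult lambda (g n)) ->
  forall z, Cmod z < 1 -> eval g z = (- (q * deval g alpha) * phi_a alpha z)%C.
Proof.
  intros Hg HTg z Hz. rewrite <- (phi_a_invol alpha z Halpha Hz) at 1.
  set (u := phi_a alpha z). assert (Hu : Cmod u < 1) by now apply Cmod_phi_a_lt_1.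
  destruct (eval_phi_a_expansion _ _ _ _ Hg Halpha (conj (Cmod_ge_0 u) Hu)) as (M & HM0 & HM).
  fold q in HM. set (d := (q * u * deval g alpha)%C).
  assert (Hl : 0 <= Cmod lambda < 1) by lra.
  assert (E0 : eval g alpha = RtoC 0).
  { assert (H0 : Cmod (RtoC 0) < 1) by (rewrite Cmod_0; lra).
    pose proof (eval_iterate g lambda (RtoC 0) 1 Hg HTg H0) as E.
    rewrite Cmult_0_r, phi_a_0, Cpow_1_r in E.
    apply Cmod_eq_0. pose proof (f_equal Cmod E) as E'. rewrite Cmod_mult in E'.
    pose proof (Cmod_ge_0 (eval g alpha)). nra. }
  assert (E : (eval g (phi_a alpha u) + d)%C = RtoC 0).
  { apply (Cmod_le_pow_eq_0 _ M (Cmod lambda) Hl). intros k.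
    pose proof (HM _ (Cmod_pow_lambda u k)) as B.
    rewrite (eval_iterate g lambda) in B by assumption. rewrite E0 in B.
    replace (lambda ^ k * eval g (phi_a alpha u) - 0 + q * (lambda ^ k * u) * deval g alpha)%C
      with (lambda ^ k * (eval g (phi_a alpha u) + d))%C in B by (unfold d; ring).
    rewrite !Cmod_mult, !Cmod_pow in B.
    set (t := Cmod lambda ^ k) in *. assert (Ht0 : 0 < t) by (apply pow_lt; lra).
    set (X := Cmod (eval g (phi_a alpha u) + d)) in *.
    apply Rmult_le_reg_l with t; [exact Ht0|].
    pose proof (Cmod_ge_0 u).
    assert ((t * Cmod u) ^ 2 <= t ^ 2) by (apply pow_incr; nra). nra. }
  replace (eval g (phi_a alpha u)) with (eval g (phi_a alpha u) + d - d)%C by ring.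
  rewrite E. unfold d. ring.
Qed.

End CompositionOperator.

(** * Kernels for evaluation and derivative *)

Lemma ipA2_csum (beta : nat) (f g : nat -> C) (l : C) :
  csum (fun n => RtoC (wgt beta n) * (f n * Cconj (g n)))%C l -> ipA2 beta f g = l.
Proof.
  intros H. rewrite <- (csum_CSeries _ _ H). unfold ipA2, CSeries.
  f_equal; apply Series_ext; intros n; unfold Re, Im, RtoC, Cmult; simpl; ring.
Qed.

Lemma ipA2_self (beta : nat) (f : nat -> C) :
  ipA2 beta f f = RtoC (Series (fun n => wgt beta n * Cmod (f n) ^ 2)).
Proof.
  unfold ipA2, RtoC. f_equal.
  - apply Series_ext. intros n. rewrite Cmod2_alt. destruct (f n). simpl. ring.
  - rewrite <- (is_series_unique _ _ (is_series_single 0%nat 0)).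
    apply Series_ext. intros n. transitivity 0; [|now destruct (Nat.eqb n 0)].
    destruct (f n). simpl. ring.
Qed.

Definition single (k : nat) (c : C) (n : nat) : C := if Nat.eqb n k then c else RtoC 0.

Lemma inA2_single (beta k : nat) (c : C) : inA2 beta (single k c).
Proof.
  exists (wgt beta k * Cmod c ^ 2).
  apply is_series_ext with (fun n => if Nat.eqb n k then wgt beta k * Cmod c ^ 2 else 0);
    [|apply is_series_single].
  intros n. unfold single. destruct (Nat.eqb_spec n k) as [->|_]; [reflexivity|].
  rewrite Cmod_0. change (0 = wgt beta n * 0 ^ 2). ring.
Qed.

Lemma ipA2_single (beta k : nat) (c : C) (g : nat -> C) :
  ipA2 beta (single k c) g = (RtoC (wgt beta k) * (c * Cconj (g k)))%C.
Proof.
  apply ipA2_csum.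
  replace (fun n => RtoC (wgt beta n) * (single k c n * Cconj (g n)))%C with
    (fun n => if Nat.eqb n k then RtoC (wgt beta k) * (c * Cconj (g k)) else RtoC 0)%C.
  - apply csum_single.
  - apply functional_extensionality; intros n. unfold single.
    destruct (Nat.eqb_spec n k) as [->|_]; [reflexivity | ring].
Qed.

(** Monomials read off the coefficients one by one. This identifies the adjoint on the kernels from
    the action of [T] under evaluation. *)
Lemma ipA2_inj (beta : nat) (g h : nat -> C) :
  (forall f, inA2 beta f -> ipA2 beta f g = ipA2 beta f h) -> g = h.
Proof.
  intros H. apply functional_extensionality; intros n.
  pose proof (H _ (inA2_single beta n 1)) as E. rewrite !ipA2_single, !Cmult_1_l in E.
  rewrite <- (Cconj_conj (g n)), <- (Cconj_conj (h n)). f_equal.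
  apply Cmult_eq_reg_l with (RtoC (wgt beta n)); [exact E|].
  intros H0. apply RtoC_inj in H0. pose proof (wgt_pos beta n). lra.
Qed.

Lemma inA2_scal (beta : nat) (c : C) (f : nat -> C) :
  inA2 beta f -> inA2 beta (fun n => c * f n)%C.
Proof.
  intros H. apply (ex_series_ext (fun n => Cmod c ^ 2 * (wgt beta n * Cmod (f n) ^ 2))).
  - intros n. rewrite Cmod_mult.
    change (Cmod c ^ 2 * (wgt beta n * Cmod (f n) ^ 2) = wgt beta n * (Cmod c * Cmod (f n)) ^ 2). ring.
  - exact (ex_series_scal (Cmod c ^ 2) _ H).
Qed.

(** The Taylor coefficients of the reproducing kernel [(1 - Cconj a * z) ^ (-(beta + 2))]. *)
Definition kern (beta : nat) (a : C) (n : nat) : C := (RtoC (/ wgt beta n) * Cconj a ^ n)%C.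

(** The formal derivative of [kern] in [Cconj a], which represents [f'(a)]. *)
Definition dkern (beta : nat) (a : C) (n : nat) : C :=
  (RtoC (/ wgt beta n) * (RtoC (INR n) * Cconj a ^ pred n))%C.

Lemma pow_sqr (x : R) (n : nat) : (x ^ n) ^ 2 = (x ^ 2) ^ n.
Proof. rewrite <- !pow_mult. f_equal. lia. Qed.

Lemma csum_geom (w : C) : Cmod w < 1 -> csum (fun n => w ^ n)%C (/ (1 - w))%C.
Proof.
  intros Hw.
  assert (Hex : ex_series (fun n => Cmod w ^ n)).
  { apply ex_series_geom. rewrite Rabs_pos_eq; [exact Hw | apply Cmod_ge_0]. }
  assert (H : csum (fun n => w ^ n)%C (CSeries (fun n => w ^ n)%C)).
  { apply csum_abs with (fun n => Cmod w ^ n); [|exact Hex].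
    intros n. rewrite Cmod_pow. lra. }
  set (G := CSeries _) in H.
  (* Splitting off the first term gives [G = 1 + w * G]. *)
  pose proof (csum_decr_1 (fun n => w ^ n)%C _ (csum_scal w _ _ H)) as H'.
  pose proof (csum_unique _ _ _ H H') as E. change (w ^ 0)%C with (RtoC 1) in E.
  assert (Hn : (1 - w)%C <> RtoC 0).
  { intros E0. pose proof (one_minus_conj_mul_neq_0 (Cconj w) 1) as Hne.
    rewrite Cmod_conj, Cmod_1, Cconj_conj, Cmult_1_r in Hne. apply Hne; [exact Hw | lra | exact E0]. }
  replace (/ (1 - w))%C with G; [exact H|].
  apply Cmult_eq_reg_l with (1 - w)%C; [|exact Hn]. rewrite Cinv_r by exact Hn.
  replace ((1 - w) * G)%C with (G - w * G)%C by ring. rewrite E at 1. ring.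
Qed.

Section Kernels.

Variables (beta : nat) (a : C).
Hypothesis Ha : 0 < Cmod a < 1.

Let r := Cmod a ^ 2.

Lemma Cmod_sqr_bounds : 0 < r < 1.
Proof. unfold r. split; nra. Qed.

Lemma Cconj_pow_mult_pow (n : nat) : (Cconj a ^ n * a ^ n)%C = RtoC (r ^ n).
Proof.
  rewrite <- Cpow_mult_l, RtoC_pow. f_equal. unfold r. rewrite Cmod2_conj. ring.
Qed.

Lemma wgt_mult_inv (x : C) (n : nat) : (RtoC (wgt beta n) * (RtoC (/ wgt beta n) * x))%C = x.
Proof.
  rewrite Cmult_assoc, <- RtoC_mult, Rinv_r, Cmult_1_l; [reflexivity|].
  pose proof (wgt_pos beta n). lra.
Qed.

Lemma inA2_of_le (f : nat -> C) (M : R) :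
  (forall n, wgt beta n * Cmod (f n) ^ 2 <= M * ((INR n + 1) ^ 2 * / wgt beta n * r ^ n)) ->
  inA2 beta f.
Proof.
  intros H.
  refine (ex_series_le (V := R_CompleteNormedModule) _ _ _
    (ex_series_scal M _ (ex_series_inv_wgt beta r Cmod_sqr_bounds))).
  intros n. unfold norm; simpl. unfold abs; simpl. rewrite Rabs_pos_eq; [apply H|].
  apply Rmult_le_pos; [apply Rlt_le, wgt_pos | apply pow2_ge_0].
Qed.

Lemma inA2_kern : inA2 beta (kern beta a).
Proof.
  apply inA2_of_le with 1. intros n. unfold kern.
  pose proof (wgt_pos beta n) as Hw. pose proof (Rinv_0_lt_compat _ Hw).
  rewrite Cmod_mult, Cmod_R, Cmod_pow, Cmod_conj, (Rabs_pos_eq (/ _)) by lra.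
  rewrite Rpow_mult_distr, pow_sqr. fold r.
  replace (wgt beta n * ((/ wgt beta n) ^ 2 * r ^ n)) with (/ wgt beta n * r ^ n) by (field; lra).
  pose proof (pow_lt r n (proj1 Cmod_sqr_bounds)). pose proof (pos_INR n).
  assert (0 < / wgt beta n * r ^ n) by (apply Rmult_lt_0_compat; assumption). nra.
Qed.

Lemma inA2_dkern : inA2 beta (dkern beta a).
Proof.
  apply inA2_of_le with (/ r). intros n. unfold dkern.
  pose proof (wgt_pos beta n) as Hw. pose proof (Rinv_0_lt_compat _ Hw).
  pose proof Cmod_sqr_bounds as Hr. pose proof (pos_INR n) as Hn.
  rewrite !Cmod_mult, !Cmod_R, Cmod_pow, Cmod_conj, (Rabs_pos_eq (/ _)), (Rabs_pos_eq (INR n)) by lra.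
  rewrite !Rpow_mult_distr, pow_sqr. fold r.
  replace (wgt beta n * ((/ wgt beta n) ^ 2 * (INR n ^ 2 * r ^ pred n)))
    with (/ wgt beta n * (INR n ^ 2 * r ^ pred n)) by (field; lra).
  replace (/ r * ((INR n + 1) ^ 2 * / wgt beta n * r ^ n))
    with (/ wgt beta n * (/ r * ((INR n + 1) ^ 2 * r ^ n))) by ring.
  apply Rmult_le_compat_l; [lra|].
  pose proof (pow_lt r n (proj1 Hr)) as Hrn. pose proof (Rinv_0_lt_compat _ (proj1 Hr)).
  destruct n as [|n].
  - replace (INR 0 ^ 2 * r ^ pred 0) with 0 by (simpl; ring).
    apply Rmult_le_pos; [lra|]. apply Rmult_le_pos; [apply pow2_ge_0 | lra].
  - simpl pred. replace (/ r * ((INR (S n) + 1) ^ 2 * r ^ S n)) with ((INR (S n) + 1) ^ 2 * r ^ n)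
      by (simpl pow; field; lra).
    apply Rmult_le_compat_r; [apply pow_le; lra|]. nra.
Qed.

Lemma ipA2_kern (f : nat -> C) : inA2 beta f -> ipA2 beta f (kern beta a) = eval f a.
Proof.
  intros Hf. apply ipA2_csum.
  replace (fun n => RtoC (wgt beta n) * (f n * Cconj (kern beta a n)))%C with (fun n => f n * a ^ n)%C.
  - apply (csum_eval beta); [exact Hf | lra].
  - apply functional_extensionality; intros n. unfold kern.
    rewrite Cmult_conj, Cconj_R, Cpow_conj, Cconj_conj.
    rewrite <- (wgt_mult_inv (f n * a ^ n) n). ring.
Qed.

(** The scalar is carried along so that the adjoint applied to [dkern] can be recognised as
    [Cconj lambda] times [dkern]. *)
Lemma ipA2_scal_dkern (f : nat -> C) (c : C) : inA2 beta f ->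
  ipA2 beta f (fun n => Cconj c * dkern beta a n)%C = (c * deval f a)%C.
Proof.
  intros Hf. apply ipA2_csum.
  replace (fun n => RtoC (wgt beta n) * (f n * Cconj (Cconj c * dkern beta a n)))%C
    with (fun n => c * (f n * (RtoC (INR n) * a ^ pred n)))%C.
  - apply csum_scal, (csum_deval beta); [exact Hf | lra].
  - apply functional_extensionality; intros n. unfold dkern.
    rewrite !Cmult_conj, !Cconj_R, Cpow_conj, !Cconj_conj.
    rewrite <- (wgt_mult_inv (f n * (RtoC (INR n) * a ^ pred n)) n). ring.
Qed.

Lemma ipA2_dkern (f : nat -> C) : inA2 beta f -> ipA2 beta f (dkern beta a) = deval f a.
Proof.
  intros Hf. rewrite <- (Cmult_1_l (deval f a)), <- ipA2_scal_dkern by exact Hf.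
  f_equal. apply functional_extensionality; intros n. rewrite Cconj_R. ring.
Qed.

(** * Moments and the Gram matrix of the two kernels *)

(* [1 / wgt] has generating function [G(r) = (1 - r)^(-(beta + 2))], and [moment j = (r d/dr)^j G(r)]. *)
Definition moment (j : nat) : R := Series (fun n => INR n ^ j * / wgt beta n * r ^ n).

Lemma ex_series_moment (j : nat) :
  (j <= 2)%nat -> ex_series (fun n => INR n ^ j * / wgt beta n * r ^ n).
Proof.
  intros Hj.
  refine (ex_series_le (V := R_CompleteNormedModule) _ _ _
    (ex_series_inv_wgt beta r Cmod_sqr_bounds)).
  intros n.
  change (Rabs (INR n ^ j * / wgt beta n * r ^ n) <= (INR n + 1) ^ 2 * / wgt beta n * r ^ n).
  pose proof (pow_lt r n (proj1 Cmod_sqr_bounds)) as Hrn. pose proof (pos_INR n) as Hn.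
  pose proof (Rinv_0_lt_compat _ (wgt_pos beta n)) as Hw.
  pose proof (pow_le (INR n) j Hn) as Hnj.
  assert (Hw' : 0 < / wgt beta n * r ^ n) by (apply Rmult_lt_0_compat; assumption).
  rewrite !Rmult_assoc, Rabs_pos_eq by (apply Rmult_le_pos; lra).
  apply Rmult_le_compat_r; [lra|].
  destruct j as [|[|[|j]]]; [simpl; nra | simpl; nra | simpl; nra | lia].
Qed.

Lemma csum_moment (j : nat) (u : nat -> C) : (j <= 2)%nat ->
  (forall n, u n = RtoC (INR n ^ j * / wgt beta n * r ^ n)) -> csum u (RtoC (moment j)).
Proof.
  intros Hj Hu. replace u with (fun n => RtoC (INR n ^ j * / wgt beta n * r ^ n)).
  - apply csum_real, Series_correct, ex_series_moment, Hj.
  - apply functional_extensionality; intros n. now rewrite Hu.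
Qed.

Lemma eval_kern : eval (kern beta a) a = RtoC (moment 0).
Proof.
  apply csum_CSeries, csum_moment; [lia|]. intros n. unfold kern.
  rewrite <- Cmult_assoc, Cconj_pow_mult_pow, <- RtoC_mult. f_equal. simpl. ring.
Qed.

Lemma Cconj_pow_pred (n : nat) :
  (Cconj a * (RtoC (INR n) * Cconj a ^ pred n))%C = (RtoC (INR n) * Cconj a ^ n)%C.
Proof.
  destruct n as [|n]; [simpl; ring|]. rewrite Cpow_S. simpl pred. ring.
Qed.

Lemma pow_pred_mult (n : nat) :
  (a * (RtoC (INR n) * a ^ pred n))%C = (RtoC (INR n) * a ^ n)%C.
Proof.
  destruct n as [|n]; [simpl; ring|]. rewrite Cpow_S. simpl pred. ring.
Qed.

(** The evaluation is the inner product of [dkern] with [kern]; the factor [Cconj a] restores the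
    exponent lowered by [pred] and makes the sum real. *)
Lemma eval_dkern : (Cconj a * eval (dkern beta a) a)%C = RtoC (moment 1).
Proof.
  assert (Ha1 : Cmod a < 1) by lra.
  apply (csum_unique (fun n => Cconj a * (dkern beta a n * a ^ n))%C).
  - apply csum_scal, (csum_eval beta); [exact inA2_dkern | exact Ha1].
  - apply csum_moment; [lia|]. intros n. unfold dkern.
    replace (Cconj a * (RtoC (/ wgt beta n) * (RtoC (INR n) * Cconj a ^ pred n) * a ^ n))%C
      with (RtoC (/ wgt beta n) * (Cconj a * (RtoC (INR n) * Cconj a ^ pred n)) * a ^ n)%C by ring.
    rewrite Cconj_pow_pred.
    replace (RtoC (/ wgt beta n) * (RtoC (INR n) * Cconj a ^ n) * a ^ n)%C
      with (RtoC (/ wgt beta n) * RtoC (INR n) * (Cconj a ^ n * a ^ n))%C by ring.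
    rewrite Cconj_pow_mult_pow, <- !RtoC_mult. f_equal. simpl. ring.
Qed.

(** The derivative here is the squared norm of [dkern]; [r], the product of [a] and its conjugate,
    restores both lowered exponents. *)
Lemma deval_dkern : (RtoC r * deval (dkern beta a) a)%C = RtoC (moment 2).
Proof.
  assert (Ha1 : Cmod a < 1) by lra.
  apply (csum_unique (fun n => RtoC r * (dkern beta a n * (RtoC (INR n) * a ^ pred n)))%C).
  - apply csum_scal, (csum_deval beta); [exact inA2_dkern | exact Ha1].
  - apply csum_moment; [lia|]. intros n. unfold dkern, r. rewrite Cmod2_conj. fold r.
    replace (a * Cconj a * (RtoC (/ wgt beta n) * (RtoC (INR n) * Cconj a ^ pred n) * (RtoC (INR n) * a ^ pred n)))%C
      with (RtoC (/ wgt beta n) * (Cconj a * (RtoC (INR n) * Cconj a ^ pred n)) *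
            (a * (RtoC (INR n) * a ^ pred n)))%C by ring.
    rewrite Cconj_pow_pred, pow_pred_mult.
    replace (RtoC (/ wgt beta n) * (RtoC (INR n) * Cconj a ^ n) * (RtoC (INR n) * a ^ n))%C
      with (RtoC (/ wgt beta n) * RtoC (INR n) * RtoC (INR n) * (Cconj a ^ n * a ^ n))%C by ring.
    rewrite Cconj_pow_mult_pow, <- !RtoC_mult. f_equal. simpl. ring.
Qed.

Let s := INR beta + 2.

(** The differential equation [(1 - r) * G' = s * G], read on coefficients through [inv_wgt_S] after
    an index shift; the term at 0 vanishes. *)
Lemma moment_1 : moment 1 = r * (moment 1 + s * moment 0).
Proof.
  unfold moment at 1. rewrite Series_incr_1 by (apply ex_series_moment; lia).
  replace (INR 0 ^ 1 * / wgt beta 0 * r ^ 0) with 0 by (simpl; ring). rewrite Rplus_0_l.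
  unfold moment. rewrite <- Series_scal_l, <- Series_plus, <- Series_scal_l.
  - apply Series_ext. intros n. rewrite S_INR. simpl pow. unfold s.
    pose proof (inv_wgt_S beta n) as E.
    transitivity ((INR n + 1) * / wgt beta (S n) * (r * r ^ n)); [ring|]. rewrite E. ring.
  - apply ex_series_moment; lia.
  - exact (ex_series_scal s _ (ex_series_moment 0 ltac:(lia))).
Qed.

(** The same shift with one more factor [n + 1], where [(n + 1) * (n + s) = n ^ 2 + (s + 1) * n +
    s]. *)
Lemma moment_2 : moment 2 = r * (moment 2 + ((s + 1) * moment 1 + s * moment 0)).
Proof.
  unfold moment at 1. rewrite Series_incr_1 by (apply ex_series_moment; lia).
  replace (INR 0 ^ 2 * / wgt beta 0 * r ^ 0) with 0 by (simpl; ring). rewrite Rplus_0_l.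
  pose proof (ex_series_scal s _ (ex_series_moment 0 ltac:(lia))) as H0.
  pose proof (ex_series_scal (s + 1) _ (ex_series_moment 1 ltac:(lia))) as H1.
  unfold moment. rewrite <- !Series_scal_l, <- !Series_plus, <- Series_scal_l.
  - apply Series_ext. intros n. rewrite S_INR. simpl pow. unfold s.
    pose proof (inv_wgt_S beta n) as E.
    transitivity ((INR n + 1) * ((INR n + 1) * / wgt beta (S n)) * (r * r ^ n)); [ring|]. rewrite E. ring.
  - apply ex_series_moment; lia.
  - exact (ex_series_plus _ _ H1 H0).
  - exact H1.
  - exact H0.
Qed.

Lemma moment_0_pos : 0 < moment 0.
Proof.
  assert (Hpos : forall n, 0 < INR n ^ 0 * / wgt beta n * r ^ n).
  { intros n. simpl pow. pose proof (Rinv_0_lt_compat _ (wgt_pos beta n)).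
    pose proof (pow_lt r n (proj1 Cmod_sqr_bounds)). rewrite Rmult_1_l.
    now apply Rmult_lt_0_compat. }
  pose proof (ex_series_moment 0 ltac:(lia)) as Hex.
  unfold moment. rewrite Series_incr_1 by exact Hex.
  apply Rplus_lt_le_0_compat; [apply Hpos|].
  apply Series_nonneg; [intros n; apply Rlt_le, Hpos|]. exact (proj1 (ex_series_incr_1 _) Hex).
Qed.

(** The squared cosine [s * r / (1 + s * r)] of the angle between the kernels, without denominators:
    the recurrences express [moment 0] and [moment 2] as multiples of [moment 1]. *)
Lemma moment_identity : s * r * (moment 0 * moment 2) = moment 1 ^ 2 * (1 + s * r).
Proof.
  pose proof moment_1 as H1. pose proof moment_2 as H2. pose proof Cmod_sqr_bounds as Hr.
  assert (E0 : s * r * moment 0 = (1 - r) * moment 1) by lra.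
  assert (E2 : (1 - r) * moment 2 = (1 + s * r) * moment 1) by nra.
  replace (s * r * (moment 0 * moment 2)) with ((s * r * moment 0) * moment 2) by ring.
  rewrite E0. transitivity (moment 1 * ((1 - r) * moment 2)); [ring|]. rewrite E2. ring.
Qed.

Lemma moment_1_pos : 0 < moment 1.
Proof.
  pose proof moment_1 as H1. pose proof moment_0_pos as H0. pose proof Cmod_sqr_bounds as Hr.
  pose proof (pos_INR beta) as Hb.
  assert (0 < s * r * moment 0) by (unfold s; repeat apply Rmult_lt_0_compat; lra). nra.
Qed.

(** * Taylor coefficients of [phi_a] *)

Definition phi_coef (n : nat) : C :=
  match n with O => a | S m => (- (1 - Cconj a * a) * Cconj a ^ m)%C end.

Lemma eval_phi_coef (z : C) : Cmod z < 1 -> eval phi_coef z = phi_a a z.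
Proof.
  intros Hz. apply csum_CSeries. pose proof (Cmod_ge_0 z).
  assert (Hn : (1 - Cconj a * z)%C <> RtoC 0) by (apply one_minus_conj_mul_neq_0; lra).
  (* The constant term is split off; the rest is a geometric series in [Cconj a * z]. *)
  replace (phi_a a z) with (phi_coef 0 * z ^ 0 + - (1 - Cconj a * a) * z * / (1 - Cconj a * z))%C.
  - apply (csum_decr_1 (fun n => phi_coef n * z ^ n)%C).
    replace (fun n => phi_coef (S n) * z ^ S n)%C
      with (fun n => - (1 - Cconj a * a) * z * (Cconj a * z) ^ n)%C.
    + apply csum_scal, csum_geom. rewrite Cmod_mult, Cmod_conj. nra.
    + apply functional_extensionality; intros n. rewrite Cpow_mult_l, Cpow_S. simpl phi_coef. ring.
  - unfold phi_a. simpl. field. exact Hn.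
Qed.

Lemma wgt_phi_coef_S (n : nat) :
  wgt beta (S n) * Cmod (phi_coef (S n)) ^ 2 = (1 - r) ^ 2 * (wgt beta (S n) * r ^ n).
Proof.
  pose proof Cmod_sqr_bounds as Hr. simpl phi_coef.
  rewrite Cmod_mult, Cmod_opp, one_minus_conj_self, Cmod_R, Cmod_pow, Cmod_conj. fold r.
  rewrite Rabs_pos_eq by lra. rewrite Rpow_mult_distr, pow_sqr. fold r. ring.
Qed.

Lemma wgt_phi_coef_S_le (n : nat) :
  0 <= wgt beta (S n) * Cmod (phi_coef (S n)) ^ 2 <= (1 - r) ^ 2 * wgt beta 1 * r ^ n.
Proof.
  split; [apply Rmult_le_pos; [apply Rlt_le, wgt_pos | apply pow2_ge_0]|].
  rewrite wgt_phi_coef_S, Rmult_assoc. apply Rmult_le_compat_l; [apply pow2_ge_0|].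
  apply Rmult_le_compat_r; [apply pow_le; pose proof Cmod_sqr_bounds; lra|].
  induction n as [|n IH]; [lra | eapply Rle_trans; [apply wgt_S_le | exact IH]].
Qed.

Lemma ex_series_geom_r : ex_series (fun n => (1 - r) ^ 2 * wgt beta 1 * r ^ n).
Proof.
  pose proof Cmod_sqr_bounds.
  refine (ex_series_scal ((1 - r) ^ 2 * wgt beta 1) _ (ex_series_geom r _)).
  rewrite Rabs_pos_eq; lra.
Qed.

Lemma inA2_phi_coef : inA2 beta phi_coef.
Proof.
  apply (proj2 (ex_series_incr_1 _)).
  refine (ex_series_le (V := R_CompleteNormedModule) _ _ _ ex_series_geom_r).
  intros n.
  change (Rabs (wgt beta (S n) * Cmod (phi_coef (S n)) ^ 2) <= (1 - r) ^ 2 * wgt beta 1 * r ^ n).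
  rewrite Rabs_pos_eq; apply wgt_phi_coef_S_le.
Qed.

(** Replacing every weight after the constant term by [wgt beta 1 = 1 / s] leaves a geometric tail
    of sum [(1 - r) / s]. The gap of [r / s] below [r + 1 / s] is what contradicts complex
    symmetry. *)
Lemma norm_phi_coef_le :
  s * Series (fun n => wgt beta n * Cmod (phi_coef n) ^ 2) <= s * r + (1 - r).
Proof.
  pose proof Cmod_sqr_bounds as Hr.
  rewrite Series_incr_1 by exact inA2_phi_coef.
  rewrite wgt_0. simpl (phi_coef 0). fold r. rewrite Rmult_1_l, Rmult_plus_distr_l.
  apply Rplus_le_compat_l.
  pose proof (Series_le _ _ wgt_phi_coef_S_le ex_series_geom_r) as H.
  rewrite Series_scal_l, Series_geom in H by (rewrite Rabs_pos_eq; lra).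
  pose proof (wgt_S beta 0) as H1. rewrite wgt_0 in H1. simpl (INR 0) in H1.
  assert (Hs : 0 < s) by (unfold s; pose proof (pos_INR beta); lra).
  eapply Rle_trans; [apply Rmult_le_compat_l; [lra | exact H]|].
  replace ((1 - r) ^ 2 * wgt beta 1 * / (1 - r)) with ((1 - r) * wgt beta 1) by (field; lra).
  assert (H2 : s * wgt beta 1 = 1) by (unfold s; lra). nra.
Qed.

End Kernels.

(** * Comparison of the two Gram matrices *)

Theorem theorem5p2 (beta : nat) (alpha lambda : C) :
  0 < Cmod alpha < 1 -> 0 < Cmod lambda < 1 ->
  forall T : (nat -> C) -> (nat -> C),
    is_comp_op beta (fun z => phi_a alpha (Cmult lambda (phi_a alpha z))) T ->
    ~ complex_symmetric beta T.
Proof.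
  intros Ha Hl T HT (Cj & S & HC & [HSin HS] & HCT).
  destruct HC as (HCin & _ & HCscal & HCinv & HCip).
  assert (Ha1 : Cmod alpha < 1) by lra.
  pose proof (Cmod_sqr_bounds alpha Ha) as Hr.
  pose proof (inA2_kern beta alpha Ha) as HK. pose proof (inA2_dkern beta alpha Ha) as HV.
  pose proof (inA2_phi_coef beta alpha Ha) as HP.
  set (K := kern beta alpha) in *. set (V := dkern beta alpha) in *.
  assert (HTin : forall f, inA2 beta f -> inA2 beta (T f)) by (intros f Hf; now apply HT).
  assert (Hinv : forall f, inA2 beta f -> Cj (Cj f) = f)
    by (intros f Hf; apply functional_extensionality; now apply HCinv).
  (* Pairing any [f] with [S K] gives the value of [T f] at [alpha], which is that of [f]; the same
     with derivatives yields [HSV]. *)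
  assert (HSK : S K = K).
  { apply (ipA2_inj beta). intros f Hf. rewrite <- HS by assumption. unfold K.
    rewrite !ipA2_kern by auto.
    now apply (eval_comp_op_fixpoint beta alpha lambda). }
  assert (HSV : S V = (fun n => Cconj lambda * V n)%C).
  { apply (ipA2_inj beta). intros f Hf. rewrite <- HS by assumption. unfold V.
    rewrite ipA2_dkern, ipA2_scal_dkern by auto.
    now apply (deval_comp_op_fixpoint beta alpha lambda). }
  (* [C T = T^* C] and [C^2 = I] give [T C = C T^*] *)
  assert (HTC : forall f, inA2 beta f -> T (Cj f) = Cj (S f)).
  { intros f Hf. rewrite <- (Hinv (T (Cj f))) by auto. f_equal.
    apply functional_extensionality; intros n. rewrite HCT by auto. now rewrite Hinv. }
  assert (HTK : forall n, T (Cj K) n = Cj K n) by (intros n; now rewrite HTC, HSK).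
  (* Conjugate linearity of [Cj] turns the eigenvalue [Cconj lambda] back into [lambda]. *)
  assert (HTV : forall n, T (Cj V) n = (lambda * Cj V n)%C).
  { intros n. rewrite HTC, HSV, HCscal, Cconj_conj by assumption. reflexivity. }
  pose proof (HCin _ HK) as HCK. pose proof (HCin _ HV) as HCV.
  set (c := eval (Cj K) alpha).
  set (d := (- ((1 - Cconj alpha * alpha) * deval (Cj V) alpha))%C).
  assert (EK : Cj K = single 0 c).
  { apply functional_extensionality.
    apply (eval_inj beta); [exact HCK | apply inA2_single|]. intros z Hz.
    rewrite (eigenvector_1_constant beta alpha lambda T Ha1 Hl HT _ HCK HTK z Hz).
    fold c. symmetry. apply csum_CSeries.
    replace (fun n => single 0 c n * z ^ n)%C with (fun n => if Nat.eqb n 0 then c else RtoC 0).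
    - apply csum_single.
    - apply functional_extensionality; intros [|n]; unfold single; simpl; ring. }
  assert (EV : Cj V = (fun n => d * phi_coef alpha n)%C).
  { apply functional_extensionality.
    apply (eval_inj beta); [exact HCV | now apply inA2_scal|]. intros z Hz.
    rewrite (eigenvector_lambda_multiple beta alpha lambda T Ha1 Hl HT _ HCV HTV z Hz).
    fold d. rewrite <- (eval_phi_coef alpha Ha z Hz). symmetry. apply csum_CSeries.
    replace (fun n => d * phi_coef alpha n * z ^ n)%C with (fun n => d * (phi_coef alpha n * z ^ n))%C.
    - apply csum_scal, (csum_eval beta); assumption.
    - apply functional_extensionality; intros n. ring. }
  (* The three Gram entries. They become [m0 = |c|^2], [m2 = r * |d|^2 * B] and
     [m1 = r * |c| * |d|], with [B] the squared norm of [phi_a alpha]. *)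
  pose proof (HCip K K HK HK) as E1. pose proof (HCip V V HV HV) as E2.
  pose proof (HCip K V HK HV) as E3.
  rewrite EK in E1, E3. rewrite EV in E2, E3.
  unfold K at 2 in E1. unfold V at 2 in E2. unfold K in E3.
  rewrite ipA2_kern in E1, E3 by assumption. rewrite ipA2_dkern in E2 by assumption.
  rewrite ipA2_single, wgt_0, Cmult_1_l in E1, E3.
  change (single 0 c 0) with c in E1. change (phi_coef alpha 0) with alpha in E3.
  rewrite ipA2_self in E2.
  unfold K in E1. rewrite eval_kern, <- Cmod2_conj in E1 by assumption.
  apply RtoC_inj in E1.
  (* The factors [r] here and [Cconj alpha] in [E3] are those that turn the kernel entries into
     moments. *)
  apply (f_equal (Cmult (RtoC (Cmod alpha ^ 2)))) in E2.
  unfold V in E2, E3. rewrite deval_dkern, <- RtoC_mult in E2 by assumption.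
  apply RtoC_inj in E2.
  apply (f_equal (Cmult (Cconj alpha))) in E3. rewrite eval_dkern in E3 by assumption.
  apply (f_equal Cmod) in E3.
  rewrite !Cmod_mult, !Cmod_conj, Cmod_mult, Cmod_R in E3.
  pose proof (moment_1_pos beta alpha Ha) as H1.
  rewrite Rabs_pos_eq in E3 by lra.
  pose proof (moment_identity beta alpha Ha) as Hid.
  pose proof (norm_phi_coef_le beta alpha Ha) as HB.
  replace (Series (fun n => wgt beta n * Cmod (d * phi_coef alpha n) ^ 2))
    with (Cmod d ^ 2 * Series (fun n => wgt beta n * Cmod (phi_coef alpha n) ^ 2)) in E2.
  2: { rewrite <- Series_scal_l. apply Series_ext. intros n. rewrite Cmod_mult. ring. }
  set (B := Series _) in *. set (r := Cmod alpha ^ 2) in *.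
  set (m0 := moment beta alpha 0) in *. set (m1 := moment beta alpha 1) in *.
  set (m2 := moment beta alpha 2) in *. set (s := INR beta + 2) in *.
  (* The unknown scalars [c] and [d] cancel, leaving the equality of the two cosines. *)
  assert (Hm : r * (m0 * m2) = m1 ^ 2 * B).
  { rewrite <- E1, <- E2, <- E3. unfold r. ring. }
  assert (Hs : s * B = 1 + s * r).
  { apply Rmult_eq_reg_l with (m1 ^ 2); [|apply pow_nonzero; lra].
    rewrite <- Hid. transitivity (s * (m1 ^ 2 * B)); [ring|]. rewrite <- Hm. ring. }
  (* [Hs] and [HB] together force [r <= 0]. *)
  lra.
Qed.
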